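(* Let $\mathcal{A},\mathcal{B}\in\mathbb{T}_{p,n}$. Suppose that $p$ is even, and that $\mathcal{A}$ has the unique order $2$ left inverse $M(\mathcal{A})^{-1}$. If $\|M(\mathcal{A})^{-1}\cdot\mathcal{B}\|_\infty<1$, then the equation $$\mathcal{A}x^{p-1}+\mathcal{B}|x|^{p-1}=b$$ has at least one solution $x\in\mathbb{R}^n$ for any $b\in\mathbb{R}^n$.
   Context: $\mathbb{T}_{m,n}$ is the set of real $m$-th order $n$-dimensional square tensors $\mathcal{A}=(a_{i_1i_2\ldots i_m})$, with $a_{i_1\ldots i_m}\in\mathbb{R}$, $1\le i_1,\ldots,i_m\le n$ (no symmetry assumed). For $\mathcal{A}\in\mathbb{T}_{m,n}$ and $x\in\mathbb{R}^n$, $\mathcal{A}x^{m-1}\in\mathbb{R}^n$ is the vector with components $(\mathcal{A}x^{m-1})_i=\sum_{i_2,\ldots,i_m=1}^n a_{ii_2\ldots i_m}x_{i_2}\cdots x_{i_m}$. The vector $|x|$ is the componentwise absolute value of $x$, and $\mathcal{B}|x|^{p-1}$ denotes $\mathcal{B}y^{p-1}$ with $y=|x|$. For an $n\times n$ matrix $Q$ and a tensor $\mathcal{B}\in\mathbb{T}_{p,n}$, the product $Q\cdot\mathcal{B}\in\mathbb{T}_{p,n}$ is given by $(Q\cdot\mathcal{B})_{ij_2\ldots j_p}=\sum_{k=1}^n Q_{ik}\,b_{kj_2\ldots j_p}$ (this is the case of a matrix first factor of the general tensor product). The unit tensor $\mathcal{I}\in\mathbb{T}_{p,n}$ has entries $1$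 if all $p$ indices coincide and $0$ otherwise. An $n\times n$ matrix $Q$ is an order $2$ left inverse of $\mathcal{A}\in\mathbb{T}_{p,n}$ if $Q\cdot\mathcal{A}=\mathcal{I}$. The majorization matrix $M(\mathcal{A})$ of $\mathcal{A}\in\mathbb{T}_{p,n}$ is the $n\times n$ matrix with entries $M(\mathcal{A})_{ij}=a_{ij\ldots j}$. Thus the hypothesis on $\mathcal{A}$ means that $M(\mathcal{A})$ is nonsingular and $M(\mathcal{A})^{-1}$ is the unique matrix $Q$ with $Q\cdot\mathcal{A}=\mathcal{I}$. For $\mathcal{G}=(g_{i_1\ldots i_p})\in\mathbb{T}_{p,n}$, $\|\mathcal{G}\|_\infty=\max_{1\le i\le n}\sum_{i_2,\ldots,i_p=1}^n|g_{ii_2\ldots i_p}|$. *)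

(* Defs.v *)
From HB Require Import structures.
From mathcomp Require Import all_boot all_order all_algebra.
From mathcomp Require Import reals.

Set Implicit Arguments.
Unset Strict Implicit.
Unset Printing Implicit Defensive.

Import Order.TTheory GRing.Theory Num.Theory.

Local Open Scope ring_scope.

(* Order-p, n-dimensional real tensors. Operations that single out the first
   index are stated for orders of the form m.+1 and split an index tuple as
   i :: J, with J an m-tuple. *)
Definition tensor (R : realType) (p n : nat) : Type :=
  {ffun p.-tuple 'I_n -> R}.

Section TensorOperations.
Variable R : realType.

Definition tensor_unit (p n : nat) : tensor R p n :=
  [ffun J : p.-tuple 'I_n => (constant J)%:R].

Section PositiveOrder.
Variables m n : nat.
Implicit Types (A G : tensor R m.+1 n) (Q : 'M[R]_n).

(* With order p = m.+1, this is the vector A x^(p-1). *)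
Definition tensor_apply A (x : 'cV[R]_n) : 'cV[R]_n :=
  \col_(i < n) \sum_(J : m.-tuple 'I_n)
    A (cons_tuple i J) * \prod_(k < m) x (tnth J k) 0.

Definition mx_tensor_mul Q A : tensor R m.+1 n :=
  [ffun J : m.+1.-tuple 'I_n =>
    \sum_(k < n) Q (thead J) k * A (cons_tuple k (behead_tuple J))].

Definition order2_left_inverse A Q : Prop :=
  mx_tensor_mul Q A = tensor_unit m.+1 n.

Definition majorization_mx A : 'M[R]_n :=
  \matrix_(i < n, j < n) A (cons_tuple i (nseq_tuple m j)).

(* The terms are nonnegative, so 0 is a neutral starting value for the max. *)
Definition tensor_norm_inf G : R :=
  \big[Num.max/0]_(i < n) \sum_(J : m.-tuple 'I_n) `|G (cons_tuple i J)|.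

End PositiveOrder.

(* Componentwise, as opposed to the norm of a matrix. *)
Definition vec_abs (n : nat) (x : 'cV[R]_n) : 'cV[R]_n :=
  map_mx (fun t : R => `|t|) x.

End TensorOperations.

(* Main.v *)
Require Import Defs.
From HB Require Import structures.
From mathcomp Require Import boolp classical_sets reals topology normedtype.
From mathcomp Require Import derive realfun.
From mathcomp Require Import all_boot all_order all_algebra.
From mathcomp Require Import zify ring lra.

(** Let [p = m.+1] and let [Q] be the inverse of the majorization matrix of
    [A].  Multiplying the equation by the invertible matrix [Q] turns [A] into
    the unit tensor, so it is equivalent to the system
      [x_i ^+ m + (Q.B |x|^m)_i = (Q b)_i],
    in which [m] is odd and [Q.B] has norm less than 1.  The left-hand side is
    a continuous map.  On the faces of a large cube [[- r, r]^n] the odd power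
    [x_i ^+ m], equal to [r ^+ m] or [- r ^+ m], outweighs the tensor term and
    the constant, so the [i]-th component of the difference of the two sides is
    nonpositive on the face [x_i = - r] and nonnegative on the face [x_i = r].
    The Poincare-Miranda theorem ([poincare_miranda]) then yields a zero.  A
    contraction argument would not do: in the variables [y_i = x_i ^+ m] the
    perturbation is homogeneous of degree 1 but, in general, not Lipschitz.

    The Poincare-Miranda theorem is as strong as Brouwer's, and the
    combinatorial core of its proof is Scarf's lemma ([scarf]), a form of
    Sperner's lemma in which the simplices of a triangulation are replaced by
    finite sets that are extremal for several total orders.  Adjacency of
    simplices, which is a matter of geometry for a triangulation, then becomes
    a pigeonhole statement on minima for these orders
    ([card_rooms_of_inner_door]), and a parity count gives a fully labelled
    set.  For the grid points of a cube, ordered by their coordinates and by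
    the opposite of their sum, fully labelled extremal sets have a diameter
    bounded independently of the mesh, which gives a sign change of all
    components at nearly one place ([grid_sign_change]).  Uniform continuity
    and compactness turn it into an exact zero. *)

Set Implicit Arguments.
Unset Strict Implicit.
Unset Printing Implicit Defensive.

Import Order.TTheory GRing.Theory Num.Theory.
Import numFieldNormedType.Exports.

(** * Scarf's lemma *)

(** The fibres of [f] over its image are singletons except for one pair
    [{x, y}], and the points removable without shrinking the image are exactly
    [x] and [y].  This is the source of both twos in the parity argument: it
    is applied to a labelling of a room and to the map sending a coordinate to
    the vertex of a door minimising it. *)
Lemma card_redundant (T U : finType) (f : T -> U) (A : {set T}) :
  #|A| = #|f @: A|.+1 ->
  #|[set x in A | f @: (A :\ x) == f @: A]| = 2.
Proof.
move=> cardA.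
have injD z : z \in A -> f @: (A :\ z) = f @: A -> {in A :\ z &, injective f}.
  move=> zA e; apply/imset_injP; rewrite e.
  by move: cardA; rewrite (cardsD1 z) zA add1n => -[->].
have /dinjectivePn[x xA [y /andP[yx yA] fxy]] : ~~ dinjectiveb f A.
  by apply/dinjectiveP => /card_in_imset e; move: cardA; rewrite e; lia.
have imD z w : z \in A -> w \in A -> z != w -> f z = f w ->
    f @: (A :\ z) = f @: A.
  move=> zA wA zw fzw; apply/eqP; rewrite eqEsubset imsetS ?subD1set //=.
  apply/subsetP => _ /imsetP[a aA ->].
  have [->|az] := eqVneq a z; first by rewrite fzw imset_f // !inE eq_sym zw.
  by rewrite imset_f // !inE az.
rewrite (_ : [set z in A | _] = [set x; y]); first by rewrite cards2 eq_sym yx.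
apply/setP => z; rewrite !inE; apply/andP/idP => [[zA /eqP e]|].
  apply: contraTT yx; rewrite negb_or negbK => /andP[zx zy].
  by apply/eqP/(injD z zA e) => //; rewrite !inE eq_sym ?zx ?zy.
by case/orP=> /eqP->; split=> //; apply/eqP; [apply: (imD x y)|apply: (imD y x)];
  rewrite // eq_sym.
Qed.

Section Scarf.
Variables (I W : finType) (u : I -> W -> nat).
Hypothesis u_inj : forall i, injective (u i).

(** Scarf's primitive sets, for the orders that the injective functions [u i]
    put on [W]: nothing lies strictly above all the coordinatewise minima of
    [S].  Dominant sets of [#|I|] points play the part of the simplices of a
    triangulation and are called rooms; their subsets with one point less are
    the facets, called doors. *)
Definition dominant (S : {set W}) :=
  [forall y, exists i, forall w in S, u i y <= u i w].

Lemma dominantP (S : {set W}) :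
  reflect (forall y, exists i, forall w, w \in S -> u i y <= u i w)
          (dominant S).
Proof.
apply: (iffP forallP) => H y; have := H y.
  by case/existsP => i /forall_inP; exists i.
by case=> i Hi; apply/existsP; exists i; apply/forall_inP.
Qed.

Lemma dominantS (S T : {set W}) : T \subset S -> dominant S -> dominant T.
Proof.
move=> /subsetP TS /dominantP dS; apply/dominantP => y.
by have [i Hi] := dS y; exists i => w /TS/Hi.
Qed.

(** If the point [w] of [S] minimised no coordinate, it would itself lie above
    all the minima of [S]. *)
Lemma dominant_argmin (S : {set W}) (mn : I -> W) :
    (forall i, mn i \in S) -> (forall i w, w \in S -> u i (mn i) <= u i w) ->
  dominant S -> mn @: [set: I] = S.
Proof.
move=> mnS mn_min /dominantP dS; apply/setP => w; apply/imsetP/idP.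
  by case=> i _ ->.
move=> wS; have [i Hi] := dS w; exists i => //.
by apply: (u_inj (i := i)); apply/eqP; rewrite eqn_leq mn_min ?Hi.
Qed.

Lemma argmin_exists (S : {set W}) : S != set0 ->
  exists mn : I -> W, (forall i, mn i \in S) /\
    (forall i w, w \in S -> u i (mn i) <= u i w).
Proof.
case/set0Pn => w0 w0S.
exists (fun i => [arg min_(w < w0 in S) u i w]).
by split=> i; case: arg_minnP => // x.
Qed.

(** An inner facet lies in exactly two simplices.  Each point of [T] minimises
    some coordinate, and there is one coordinate too many, so exactly two
    coordinates [k] have their minimum attained at a point that also minimises
    another one.  Adding a point keeps [T] dominant only if the new point takes
    over the minimum of one such [k] and of no other coordinate, and then it
    has to be the [k]-largest among the points above the minima of all
    coordinates but [k].  The hypothesis on [k] says that such points exist: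
    the door is not on the outer boundary. *)
Lemma card_rooms_of_inner_door (T : {set W}) :
    #|I| = #|T|.+1 -> T != set0 ->
    (forall k, exists y, forall l, l != k -> exists2 t, t \in T & u l t < u l y) ->
  dominant T -> #|[set x in ~: T | dominant (x |: T)]| = 2.
Proof.
move=> cardI T0 open dT.
have [mn [mnT mn_min]] := argmin_exists T0.
have mnI := dominant_argmin mnT mn_min dT.
have cardI' : #|[set: I]| = #|mn @: [set: I]|.+1 by rewrite mnI cardsT.
pose K := [set k in [set: I] | mn @: ([set: I] :\ k) == mn @: [set: I]].
rewrite -(card_redundant cardI') -/K.
(* The candidates for taking over the minimum of the coordinate [k]. *)
pose M k := [set y | [forall l, (l != k) ==> (u l (mn l) < u l y)]].
have MP k y : reflect (forall l, l != k -> u l (mn l) < u l y) (y \in M k).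
  by rewrite inE; apply: (iffP forall_inP).
have M_neq0 k : exists y, y \in M k.
  have [y Hy] := open k; exists y; apply/MP => l /Hy[t tT].
  by apply: leq_ltn_trans; rewrite mn_min.
have /fin_all_exists[mx Hmx] k : exists x, x \in M k /\
    forall y, y \in M k -> u k y <= u k x.
  have [y0 y0M] := M_neq0 k.
  by case: (arg_maxnP (u k) y0M) => x; exists x.
have below y k : y \in M k -> u k y <= u k (mn k).
  move=> /MP yM; have /dominantP/(_ y)[i Hi] := dT.
  have [<-|ik] := eqVneq i k; first by rewrite Hi.
  by have := yM _ ik; rewrite ltnNge Hi.
have mxI : {in K &, injective mx}.
  move=> k k' _ _ e; apply/eqP/negPn/negP => kk'.
  have [/MP k1 _] := Hmx k; have [k2 _] := Hmx k'.
  by have := below _ _ k2; rewrite leqNgt -e k1 // eq_sym.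
rewrite -(card_in_imset mxI).
congr #|pred_of_set _|; apply/setP => x; rewrite !inE.
apply/andP/imsetP => [[xT dx]|[k kK ->]].
- have xT0 : x |: T != set0 by apply/set0Pn; exists x; rewrite !inE eqxx.
  have [mn' [mn'T mn'_min]] := argmin_exists xT0.
  have mn'I := dominant_argmin mn'T mn'_min dx.
  have inj' : injective mn'.
    move=> i j e; have /imset_injP inj : #|mn' @: [set: I]| == #|[set: I]|.
      by rewrite mn'I cardsU1 xT cardsT cardI add1n.
    by apply: inj; rewrite ?inE.
  have [k _ kx] : exists2 k, k \in [set: I] & x = mn' k.
    by apply/imsetP; rewrite mn'I !inE eqxx.
  have mn'E l : l != k -> mn' l \in T.
    move=> lk; have := mn'T l; rewrite !inE => /orP[/eqP|//].
    by rewrite kx => /inj'/eqP; rewrite (negbTE lk).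
  have mnE l : l != k -> mn' l = mn l.
    move=> lk; apply: (u_inj (i := l)); apply/eqP; rewrite eqn_leq.
    by rewrite mn'_min ?inE ?mnT ?orbT // mn_min // mn'E.
  have xM : x \in M k.
    apply/MP => l lk; rewrite -mnE // ltn_neqAle mn'_min ?inE ?eqxx // andbT.
    by apply/eqP => /u_inj; rewrite kx => /inj'/eqP; rewrite (negbTE lk).
  exists k.
    rewrite !inE mnI /=; apply/eqP/setP => t; apply/imsetP/idP => [[l _ ->]//|tT].
    have /imsetP[l _ tl] : t \in mn' @: [set: I] by rewrite mn'I !inE tT orbT.
    have lk : l != k by apply: contraNneq xT => lk; rewrite kx -lk -tl.
    by exists l; rewrite ?inE ?lk // -mnE.
  have [mxM mx_max] := Hmx k.
  apply: (u_inj (i := k)); apply/eqP; rewrite eqn_leq mx_max //=.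
  have /dominantP/(_ (mx k))[l Hl] := dx.
  have [lk|lk] := eqVneq l k; first by rewrite -{1 3}lk Hl ?setU11.
  have /MP/(_ l lk) := mxM; rewrite ltnNge Hl //.
  by rewrite !inE mnT orbT.
(* Conversely, adding the maximum of [M k] keeps the set dominant. *)
have [mxM mx_max] := Hmx k.
move: kK; rewrite !inE mnI => /eqP mnk; split.
  apply/negP; rewrite -{1}mnk => /imsetP[l]; rewrite !inE andbT => lk e.
  by have /MP/(_ l lk) := mxM; rewrite e ltnn.
apply/dominantP => y; have [yM|] := boolP (y \in M k).
  exists k => w; rewrite !inE => /orP[/eqP->|wT]; first exact: mx_max.
  exact: leq_trans (below _ _ yM) (mn_min _ _ wT).
rewrite inE negb_forall => /existsP[l]; rewrite negb_imply -leqNgt.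
case/andP=> lk yl; exists l => w; rewrite !inE => /orP[/eqP->|wT].
  by apply: leq_trans yl (ltnW _); have /MP := mxM; apply.
exact: leq_trans yl (mn_min _ _ wT).
Qed.

(* The slack point [s i] stands for the facet of the simplex on which the
   coordinate [i] vanishes: it is the least point for [u i] and lies above all
   ordinary points for the other orders.  Labelling it by [i] expresses
   Sperner's boundary condition. *)
Variables (s : I -> W) (c : W -> I).
Hypothesis sK : cancel s c.
Hypothesis s_min : forall i w, u i (s i) <= u i w.
Hypothesis s_max : forall i j w, i != j -> w \notin codom s ->
  u i w < u i (s j).

(** The door made of all slack points but one lies in a single room: the new
    point can only be the [i0]-largest ordinary point. *)
Lemma card_rooms_of_outer_door (i0 : I) (w0 : W) : w0 \notin codom s ->
  #|[set x in ~: (s @: [set~ i0]) | dominant (x |: s @: [set~ i0])]| = 1.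
Proof.
move=> w0s; set T := s @: _.
have [z zs z_max] := @arg_maxnP _ w0 [pred w | w \notin codom s] (u i0) w0s.
have sT l : (s l \in T) = (l != i0).
  by rewrite mem_imset ?inE //; exact: can_inj sK.
have zT : z \notin T.
  by apply: contra zs => /imsetP[l _ ->]; exact: codom_f.
have z_lt j : j != i0 -> u i0 z < u i0 (s j) by rewrite eq_sym => /s_max; apply.
rewrite (_ : [set x in _ | _] = [set z]) ?cards1 //.
apply/setP => x; rewrite !inE; apply/andP/eqP => [[xT dx]|->]; last first.
  split=> //; apply/dominantP => y; have [/codomP[l ->]|ys] := boolP (y \in codom s).
    by exists l => w _; exact: s_min.
  exists i0 => w; rewrite !inE => /orP[/eqP->|/imsetP[j]]; first exact: z_max.
  rewrite !inE => ji ->; apply: ltnW; apply: leq_ltn_trans (z_lt _ ji).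
  exact: z_max.
have /dominantP/(_ z)[l Hl] := dx.
have no_s j : s j \in x |: T -> l != j.
  move=> /Hl zj; apply: contraNneq zs => lj; rewrite lj in zj.
  have -> : z = s j.
    by apply: (u_inj (i := j)); apply/eqP; rewrite eqn_leq s_min zj.
  exact: codom_f.
have /eqP li : l == i0.
  by apply/negPn/negP => li; have := no_s l; rewrite !inE sT li orbT eqxx => /(_ isT).
have xs : x \notin codom s.
  apply/negP => /codomP[j xj]; have := xT; rewrite xj sT negbK => /eqP ji.
  by have := no_s j; rewrite -xj setU11 li ji eqxx => /(_ isT).
have zx : u i0 z <= u i0 x by rewrite -li Hl ?setU11.
by apply: (u_inj (i := i0)); apply/eqP; rewrite eqn_leq zx andbT; exact: z_max.
Qed.

(** A door missing exactly the label [i0] is inner unless it consists of slack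
    points.  For a coordinate [l], some point of [T] lies [u l]-below [s k]: it
    is [s l] or an ordinary point, and if neither belonged to [T], then [T]
    would be the set of all slack points but [s l], whose missing label is
    [l]. *)
Lemma even_rooms_of_inner_door (i0 : I) (T : {set W}) :
    c @: T = [set~ i0] -> #|I| = #|T|.+1 -> T != s @: [set~ i0] ->
  ~~ odd #|[set x in ~: T | dominant (x |: T)]|.
Proof.
move=> cT cardI Ts; have [dT|ndT] := boolP (dominant T); last first.
  rewrite (_ : [set _ in _ | _] = set0) ?cards0 //.
  apply/setP => x; rewrite !inE; apply/negbTE; rewrite negb_and; apply/orP; right.
  by apply: contra ndT; apply: dominantS; exact: subsetUr.
have [T0|T0] := eqVneq T set0.
  case/eqP: Ts; rewrite T0; apply/esym/eqP; rewrite imset_eq0 -cT T0.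
  by rewrite imset0.
rewrite card_rooms_of_inner_door // => k; exists (s k) => l lk.
have sI : injective s := can_inj sK.
have [slT|slT] := boolP (s l \in T).
  exists (s l) => //; rewrite ltn_neqAle s_min andbT.
  by apply/eqP => /u_inj/sI/eqP; rewrite (negbTE lk).
have [/exists_inP[t tT ts]|] := boolP [exists t in T, t \notin codom s].
  by exists t => //; exact: s_max.
rewrite negb_exists_in => /forall_inP Tsub; case/eqP: Ts.
have sub : T \subset s @: [set~ l].
  apply/subsetP => t tT; have /negPn/codomP[j tj] := Tsub _ tT.
  by rewrite tj imset_f // !inE; apply: contraNneq slT => <-; rewrite -tj.
have TE : T = s @: [set~ l].
  apply/eqP; rewrite eqEcard sub card_imset //.
  by have := cardsC [set l]; rewrite cards1 cardI; lia.
rewrite TE; congr (s @: _); rewrite -cT TE -imset_comp.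
by rewrite (eq_imset _ (g := id)) ?imset_id // => x /=; rewrite sK.
Qed.

(** A fully labelled room has one door missing exactly the label [i0]; a room
    with label set [[set~ i0]] has two by [card_redundant]; other rooms have
    none. *)
Lemma odd_doors_of_room (i0 : I) (S : {set W}) : #|S| = #|I| ->
  odd #|[set x in S | c @: (S :\ x) == [set~ i0]]| = (c @: S == [set: I]).
Proof.
move=> cardS; have [cS|cS] := eqVneq (c @: S) setT.
  have injc : {in S &, injective c} by apply/imset_injP; rewrite cS cardsT cardS.
  have /imsetP[x xS cx] : i0 \in c @: S by rewrite cS inE.
  rewrite (_ : [set _ in _ | _] = [set x]) ?cards1 //.
  apply/setP => y; rewrite !inE; apply/andP/eqP => [[yS /eqP e]|->].
    apply/eqP/negPn/negP => yx.
    have : i0 \in c @: (S :\ y) by apply/imsetP; exists x; rewrite // !inE xS eq_sym yx.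
    by rewrite e !inE eqxx.
  split=> //; apply/eqP/setP => i; rewrite !inE cx; apply/imsetP/idP => [[w]|ix].
    by rewrite !inE => /andP[wx wS] ->; apply: contra wx => /eqP/injc->.
  have /imsetP[w wS ciw] : i \in c @: S by rewrite cS inE.
  exists w => //; rewrite !inE wS andbT; apply: contraNneq ix => <-.
  by rewrite ciw.
have [cS0|cS0] := eqVneq (c @: S) [set~ i0].
  rewrite -cS0 card_redundant // cS0 cardS.
  by have := cardsC [set i0]; rewrite cards1; lia.
apply/negbTE; rewrite (_ : [set _ in _ | _] = set0) ?cards0 //.
apply/setP => x; rewrite !inE; apply/negbTE/negP => /andP[xS /eqP e].
have sub : [set~ i0] \subset c @: S by rewrite -e imsetS ?subD1set.
have [i0S|i0S] := boolP (i0 \in c @: S).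
  case/eqP: cS; apply/setP => i; rewrite inE.
  have [->//|ii0] := eqVneq i i0.
  by apply: (subsetP sub); rewrite !inE.
case/eqP: cS0; apply/eqP; rewrite eqEsubset sub andbT.
by apply/subsetP => i iS; rewrite !inE; apply: contraNneq i0S => <-.
Qed.

(** Incident pairs of a room and a door missing exactly [i0] are counted
    twice.  By doors, the count is odd, as the slack door alone is in an odd
    number of rooms; by rooms, its parity is that of the number of fully
    labelled rooms. *)
Theorem scarf (w0 : W) : w0 \notin codom s ->
  exists2 S : {set W}, dominant S & c @: S = [set: I].
Proof.
(* Any label can be singled out; that of [w0] is at hand. *)
move=> w0s; pose i0 := c w0.
pose room S := dominant S && (#|S| == #|I|).
pose door (T : {set W}) := (c @: T == [set~ i0]) && (#|I| == #|T|.+1).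
have count :
  \sum_(S | room S) #|[set x in S | c @: (S :\ x) == [set~ i0]]| =
  \sum_(T | door T) #|[set x in ~: T | dominant (x |: T)]|.
  under eq_bigr do rewrite -sum1dep_card big_mkcondr.
  under [RHS]eq_bigr do rewrite -sum1dep_card big_mkcondr.
  rewrite (exchange_big_dep predT) // [RHS](exchange_big_dep predT) //=.
  apply: eq_bigr => x _; rewrite -!big_mkcondr /=.
  (* For a fixed point [x], rooms containing [x] correspond to doors avoiding
     it. *)
  rewrite (reindex_onto (fun T => x |: T) (fun S => S :\ x)) /=; last first.
    by move=> S /andP[/andP[_ xS] _]; rewrite setD1K.
  apply: eq_bigl => T; rewrite setU11 !inE /=.
  have [xT|xT] := boolP (x \in T).
    rewrite !andbF /=; apply/negbTE; rewrite !negb_and.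
    by apply/orP; right; apply: contraTneq xT => <-; rewrite !inE eqxx.
  rewrite setU1K // eqxx !andbT /room /door cardsU1 xT add1n.
  by rewrite [#|I| == _]eq_sym andbC -!andbA; congr andb; rewrite andbC.
have oddR : odd (\sum_(T | door T) #|[set x in ~: T | dominant (x |: T)]|).
  have sI : injective s := can_inj sK.
  rewrite (bigD1 (s @: [set~ i0])) /=; last first.
    rewrite /door -imset_comp (eq_imset _ (g := id)) ?imset_id ?eqxx /=; last first.
      by move=> x /=; rewrite sK.
    by rewrite card_imset // -(cardsC [set i0]) cards1 add1n.
  rewrite oddD (card_rooms_of_outer_door i0 w0s) /=.
  apply: (big_ind (fun k => ~~ odd k)) => //
    [a b na nb|T /andP[/andP[/eqP cT /eqP cI]] nT].
    by rewrite oddD (negbTE na) (negbTE nb).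
  exact: (even_rooms_of_inner_door cT cI nT).
move: oddR; rewrite -count => oddR.
have [/existsP[S /and3P[dS _ /eqP cS]]|] :=
  boolP [exists S, [&& dominant S, #|S| == #|I| & c @: S == setT]].
  by exists S.
rewrite negb_exists => /forallP none.
suff : ~~ odd
    (\sum_(S | room S) #|[set x in S | c @: (S :\ x) == [set~ i0]]|).
  by rewrite oddR.
apply: (big_ind (fun k => ~~ odd k)) => // [a b na nb|S /andP[dS /eqP cardS]].
  by rewrite oddD (negbTE na) (negbTE nb).
rewrite odd_doors_of_room //; have := none S.
by rewrite dS cardS eqxx.
Qed.

End Scarf.

(** * A sign change on a grid *)

Section Grid.
Variables n M : nat.
Local Notation grid := {ffun 'I_n -> 'I_M.+1}.

(** The coordinate [None] is the slack of the sum, which turns the coordinates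
    on the grid into barycentric ones, as on a large simplex. *)
Definition coord (o : option 'I_n) (v : grid) : nat :=
  if o is Some i then v i else n * M - \sum_(i < n) v i.

(** Ties between equal coordinates are broken by an enumeration of the grid,
    because Scarf's lemma needs total orders. *)
Definition grid_key (o : option 'I_n) (v : grid) : nat :=
  coord o v * #|{: grid}| + enum_rank v.

Lemma grid_key_inj o : injective (grid_key o).
Proof.
move=> v w e; apply: enum_rank_inj; apply: val_inj => /=.
have := congr1 (modn^~ #|{: grid}|) e.
by rewrite /grid_key /= !modnMDl !modn_small.
Qed.

Lemma leq_coord o v w : grid_key o v <= grid_key o w -> coord o v <= coord o w.
Proof.
have K0 : 0 < #|{: grid}| by apply/card_gt0P; exists v.
move=> /(leq_div2r #|{: grid}|).
by rewrite /grid_key !divnMDl // !divn_small ?addn0.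
Qed.

Lemma grid_key_lt o v : grid_key o v < (n * M + M).+1 * #|{: grid}|.
Proof.
have : coord o v <= n * M + M.
  by case: o => [i|] /=; [have := ltn_ord (v i)|]; lia.
move=> le_c; apply: (@leq_trans ((coord o v).+1 * #|{: grid}|)).
  by rewrite /grid_key mulSn addnC ltn_add2r ltn_ord.
by rewrite leq_mul2r ltnS le_c orbT.
Qed.

(** Slack points are the right summands.  The large summand is the bound of
    [grid_key_lt], so that a slack point exceeds all grid points in the orders
    of the other coordinates. *)
Definition grid_order (o : option 'I_n) (w : grid + option 'I_n) : nat :=
  match w with
  | inl v => (grid_key o v).+1
  | inr o' => if o' == o then 0
              else ((n * M + M).+1 * #|{: grid}|).+1 + enum_rank o'
  end.

Lemma grid_order_inj o : injective (grid_order o).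
Proof.
move=> [v|p] [w|q] /=.
- by case=> /grid_key_inj->.
- by case: eqP => // _; have := grid_key_lt o v; lia.
- by case: eqP => // _; have := grid_key_lt o w; lia.
- case: eqP => [->|_]; case: eqP => [->|_] //.
  by move/addnI/val_inj/enum_rank_inj->.
Qed.

Variable P : 'I_n -> grid -> bool.
Hypothesis P_low : forall i (v : grid), v i = 0 :> nat -> P i v.
Hypothesis P_high : forall i (v : grid), v i = M :> nat -> ~~ P i v.

(** Read [P i v] as: the [i]-th component of a vector field is nonpositive at
    [v].  The conclusion is a discrete Poincare-Miranda theorem: all components
    are positive at [v0] and each becomes nonpositive within distance [n].
    The points are labelled by some [i] with [P i v], or by [None] if
    there is none, and Scarf's lemma gives a dominant set [S] carrying all
    labels.  Dominance, tested at the far corner, shows that the label [None]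
    is carried by a grid point [v0]; tested just above the minima of [S], it
    shows that the points of [S] are close to each other.  If the label [i] is
    carried by the slack point of [i], then [v0] is close to the face where
    the coordinate [i] vanishes, and [P i] holds on that face. *)
Lemma grid_sign_change : exists v0 : grid, (forall i, ~~ P i v0) /\
  forall i, exists2 v : grid, P i v & forall j, v j <= v0 j + n /\ v0 j <= v j + n.
Proof.
have P_lt i (v : grid) : P i v -> v i < M.
  move=> Pv; rewrite ltn_neqAle -ltnS ltn_ord andbT.
  by apply: contraTneq Pv => /P_high.
pose c (w : grid + option 'I_n) :=
  match w with inl v => [pick i | P i v] | inr o => o end.
have s_min o w : grid_order o (inr o) <= grid_order o w by rewrite /= eqxx.
have slackN v : inl v \notin codom (@inr grid (option 'I_n)).
  by apply/negP => /codomP[].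
have s_max o o' (w : grid + option 'I_n) : o != o' -> w \notin codom inr ->
    grid_order o w < grid_order o (inr o').
  case: w => [v|q] oo'; last by rewrite codom_f.
  by rewrite /= eq_sym (negbTE oo') => _; have := grid_key_lt o v; lia.
have [S dS cS] := scarf grid_order_inj (fun o => erefl : c (inr o) = o) s_min
  s_max (slackN [ffun=> ord0]).
have {}dS y : exists2 o, inr o \notin S &
    forall v, inl v \in S -> coord o y <= coord o v.
  have /dominantP/(_ (inl y))[o Ho] := dS.
  exists o; first by apply/negP => /Ho; rewrite /= eqxx.
  by move=> v /Ho /=; rewrite ltnS => /leq_coord.
have labelled o : inr o \notin S -> exists2 v, inl v \in S & [pick i | P i v] = o.
  move=> oS; have /imsetP[[v|q] wS cw] : o \in c @: S by rewrite cS inE.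
    by exists v.
  by case/negP: oS; rewrite cw.
have labelledP i : inr (Some i) \notin S -> exists2 v, inl v \in S & P i v.
  by case/labelled => v vS; case: pickP => // j Pj [<-]; exists v.
(* Otherwise the corner with all coordinates equal to [M] would force a point
   with [P i] to have its [i]-th coordinate equal to [M]. *)
have [v0 v0S v0P] : exists2 v, inl v \in S & [pick i | P i v] = None.
  apply: labelled; have [[i|] oS Hy] := dS [ffun=> ord_max] => //.
  have [v vS Pv] := labelledP _ oS; have := Hy _ vS; rewrite /= ffunE /= => Mv.
  by have := P_lt _ _ Pv; lia.
have /fin_all_exists2[mn mnS mn_le] (i : 'I_n) : exists2 w : grid, inl w \in S &
    forall v : grid, inl v \in S -> w i <= v i.
  case: (@arg_minnP _ v0 (fun v => inl v \in S) (fun v : grid => v i) v0S).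
  by move=> w; exists w.
(* [y] exceeds by one the minimum of each coordinate whose slack point is not in
   [S], and is 0 elsewhere.  Dominance at [y] can then only come from the
   coordinate [None], so the sum over any point of [S] is at most that over
   [y]. *)
pose y : grid :=
  [ffun i => inord (if inr (Some i) \in S then 0 else (mn i i).+1)].
have yE i : y i = (if inr (Some i) \in S then 0 else (mn i i).+1) :> nat.
  rewrite ffunE inordK //; case: ifPn => // iS.
  have [v vS Pv] := labelledP _ iS.
  by have := mn_le i v vS; have := P_lt _ _ Pv; lia.
have y_low i v : inl v \in S -> (y i).-1 <= v i.
  move=> vS; rewrite yE; case: ifPn => // iS.
  exact: mn_le.
have sum_le v : inl v \in S -> \sum_(i < n) v i <= \sum_(i < n) (y i).-1 + n.
  move=> vS; have [[i|] oS /= Hy] := dS y.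
    by have := Hy _ (mnS i); have := yE i; rewrite (negbTE oS); lia.
  have sumM (w : grid) : \sum_(i < n) w i <= n * M.
    have -> : n * M = \sum_(i < n) M by rewrite sum_nat_const card_ord.
    by apply: leq_sum => i _; have := ltn_ord (w i); lia.
  have : \sum_(i < n) y i <= \sum_(i < n) (y i).-1 + n.
    rewrite -[X in _ + X]card_ord -sum1_card -big_split /=.
    by apply: leq_sum => i _; lia.
  by apply: leq_trans; rewrite -(leq_sub2lE _ (sumM v)); exact: Hy.
have close v j : inl v \in S -> v j <= (y j).-1 + n.
  move=> vS; have := sum_le _ vS.
  rewrite (bigD1 j) //= [X in _ <= X + _](bigD1 j) //=.
  have arith a b d e f : a <= b -> d + b <= e + a + f -> d <= e + f by lia.
  by apply: arith; apply: leq_sum => i _; exact: y_low.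
exists v0; split=> i; first by move: v0P; case: pickP => // + _ => ->.
have [iS|iS] := boolP (inr (Some i) \in S); last first.
  have [v vS Pv] := labelledP _ iS; exists v => // j.
  by split; apply: leq_trans (close _ j _) _ => //; rewrite leq_add2r y_low.
(* [v0] pushed onto the face where the coordinate [i] vanishes. *)
exists [ffun j => if j == i then ord0 else v0 j].
  by apply: P_low; rewrite ffunE eqxx.
move=> j; rewrite ffunE; case: eqP => [->|_]; last by rewrite leq_addr.
by split=> //; have := close _ i v0S; rewrite yE iS.
Qed.

End Grid.

(** * The Poincare-Miranda theorem *)

Local Open Scope classical_set_scope.
Local Open Scope ring_scope.

Lemma compact_unif_continuous (R : realType) (V : normedModType R) (K : set V)
    (f : V -> R) (e : R) : compact K -> continuous f -> 0 < e ->
  \forall d \near 0^'+, forall x y, K x -> `|x - y| < d -> `|f x - f y| <= e.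
Proof.
move=> /compact_near_coveringP cK cf e0.
have e20 : 0 < e / 2 by rewrite divr_gt0.
pose P (d : R) (x : V) := forall y, `|x - y| < d -> `|f x - f y| <= e.
have : \forall d \near 0^'+, K `<=` P d.
  apply: cK => x _.
  have /nbhs_ballP[h /= h0 hf] : \forall y \near x, `|f x - f y| < e / 2.
    by have /cvgrPdist_lt := cf x; apply.
  have h20 : 0 < h / 2 by rewrite divr_gt0.
  near=> x' d => y /= x'y.
  have xx' : `|x - x'| < h / 2.
    near: x'; apply/nbhs_ballP; exists (h / 2) => //= z.
    by rewrite -ball_normE.
  have dh : d < h / 2 by near: d; exact: nbhs_right_lt.
  have fx' : `|f x - f x'| < e / 2.
    by apply: hf; rewrite -ball_normE /=; lra.
  have fy : `|f x - f y| < e / 2.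
    apply: hf; rewrite -ball_normE /=.
    by rewrite (le_lt_trans (ler_distD x' _ _)) //; lra.
  rewrite (le_trans (ler_distD (f x) _ _)) // [`|f x' - _|]distrC; lra.
by apply: filterS => d Pd x y Kx; exact: Pd.
Unshelve. all: by end_near.
Qed.

Lemma continuous_bigop (R : realType) (V : topologicalType) (op : R -> R -> R)
    (idx : R) (I : Type) (s : seq I) (f : I -> V -> R) :
    (forall g h : V -> R, continuous g -> continuous h ->
      continuous (fun x => op (g x) (h x))) ->
    (forall i, continuous (f i)) ->
  continuous (fun x => \big[op/idx]_(i <- s) f i x).
Proof.
move=> op_cont f_cont; elim: s => [|i s IH].
  by under eq_fun do rewrite big_nil; exact: cst_continuous.
by under eq_fun do rewrite big_cons; exact: op_cont.
Qed.

Lemma continuous_sum (R : realType) (V : topologicalType) (I : Type)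
    (s : seq I) (f : I -> V -> R) :
  (forall i, continuous (f i)) -> continuous (fun x => \sum_(i <- s) f i x).
Proof.
by apply: continuous_bigop => g h cg ch x; apply: continuousD; [exact: cg|exact: ch].
Qed.

Lemma continuous_prod (R : realType) (V : topologicalType) (I : Type)
    (s : seq I) (f : I -> V -> R) :
  (forall i, continuous (f i)) -> continuous (fun x => \prod_(i <- s) f i x).
Proof.
by apply: continuous_bigop => g h cg ch x; apply: continuousM; [exact: cg|exact: ch].
Qed.

Definition cube (R : realType) n (r : R) : set 'rV[R]_n :=
  [set x | forall i, x ord0 i \in `[- r, r]].

Lemma cube_compact (R : realType) n (r : R) : compact (@cube R n r).
Proof.
by apply: (@rV_compact _ _ (fun=> `[- r, r]%classic)) => _; exact: segment_compact.
Qed.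

Section PoincareMiranda.
Variables (R : realType) (n : nat) (r : R) (H : 'I_n -> 'rV[R]_n -> R).
Hypothesis r_gt0 : 0 < r.
Hypothesis H_low : forall i x, cube r x -> x ord0 i = - r -> H i x <= 0.
Hypothesis H_high : forall i x, cube r x -> x ord0 i = r -> 0 <= H i x.

(** The sign change on a grid of mesh so small that [n] steps are shorter than
    the modulus of continuity [d]. *)
Lemma poincare_miranda_approx (e d : R) : 0 < d ->
    (forall i x y, cube r x -> `|x - y| < d -> `|H i x - H i y| <= e) ->
  exists2 x, cube r x & forall i, `|H i x| <= e.
Proof.
move=> d0 Hd.
have [N] : exists N : nat, 2 * r * n%:R / d < N.+1%:R.
  exists (Num.bound (2 * r * n%:R / d)); apply: (lt_trans (archi_boundP _)).
    by rewrite divr_ge0 ?(ltW d0) ?mulr_ge0 ?(ltW r_gt0).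
  by rewrite ltr_nat.
set M := N.+1 => NM.
have M0 : 0 < M%:R :> R by rewrite ltr0n.
pose step := 2 * r / M%:R.
have step0 : 0 < step by rewrite divr_gt0 ?mulr_gt0.
have stepM : step * M%:R = 2 * r by rewrite divfK ?gt_eqF.
pose pt (v : {ffun 'I_n -> 'I_M.+1}) : 'rV[R]_n :=
  \row_j (- r + step * (v j)%:R).
have pt_cube v : cube r (pt v).
  move=> j; rewrite mxE in_itv /=.
  have : 0 <= step * (v j)%:R by rewrite mulr_ge0 ?(ltW step0).
  have : step * (v j)%:R <= step * M%:R by rewrite ler_pM2l // ler_nat -ltnS.
  by rewrite stepM; lra.
(* The face where the [i]-th coordinate is [r] is excluded explicitly, because
   [H i] may vanish there. *)
pose P i (v : {ffun 'I_n -> 'I_M.+1}) := (v i < M)%N && (H i (pt v) <= 0).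
have [||v0 [v0P near_v0]] := @grid_sign_change n M P.
- move=> i v v0; rewrite /P v0 /=; apply: H_low => //.
  by rewrite mxE v0 mulr0 addr0.
- by move=> i v vM; rewrite /P vM ltnn.
exists (pt v0) => // i; rewrite ler_norml; apply/andP; split.
  apply: (@le_trans _ _ 0).
    rewrite oppr_le0; have := Hd i (pt v0) (pt v0) (pt_cube v0).
    by rewrite !subrr !normr0; apply.
  have := v0P i; rewrite negb_and -leqNgt -ltNge => /orP[Mv|/ltW//].
  apply: H_high => //; rewrite mxE.
  have -> : v0 i = M :> nat by apply/eqP; rewrite eqn_leq Mv -ltnS ltn_ord.
  by rewrite stepM; ring.
have [v /andP[_ Hv] close] := near_v0 i.
have : `|H i (pt v0) - H i (pt v)| <= e.
  apply: Hd => //; rewrite [ltLHS]mx_normrE; apply: bigmax_lt => //= -[k j] _.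
  rewrite !mxE /=.
  have -> : - r + step * (v0 j)%:R - (- r + step * (v j)%:R) =
            step * ((v0 j)%:R - (v j)%:R) by ring.
  rewrite normrM gtr0_norm //.
  apply: (@le_lt_trans _ _ (step * n%:R)).
    rewrite ler_pM2l // ler_norml.
    have [] := close j; rewrite -!(ler_nat R) !natrD => c1 c2.
    by apply/andP; split; lra.
  by rewrite /step mulrAC ltr_pdivrMr // -ltr_pdivrMl // mulrC.
by move/ler_normlP => [_]; lra.
Qed.

Hypothesis H_cont : forall i, continuous (H i).

(** Equivalent to Brouwer's fixed point theorem.  The sum of the [`|H i|]
    attains its minimum on the compact cube, and the approximate zeros make
    that minimum 0. *)
Theorem poincare_miranda : exists2 x, cube r x & forall i, H i x = 0.
Proof.
pose F (x : 'rV[R]_n) : R := \sum_(i < n) `|H i x|.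
have [||x0 x0K F_min] := @compact_EVT_min _ R F (cube r) _ (@cube_compact R n r).
- by exists 0 => i; rewrite mxE in_itv /= oppr_le0 ltW.
- apply: continuous_subspaceT; apply: continuous_sum => i x.
  by apply: continuous_comp; [exact: H_cont|exact: norm_continuous].
have F0 : F x0 <= 0.
  apply/ler_addgt0Pr => e e0; rewrite add0r.
  pose e' := e / n.+1%:R; have e'0 : 0 < e' by rewrite divr_gt0 ?ltr0n.
  have : \forall d \near 0^'+, 0 < d /\ forall i x y, cube r x ->
      `|x - y| < d -> `|H i x - H i y| <= e'.
    near=> d; split; first by near: d; exact: nbhs_right_gt.
    near: d; apply: filter_forall => i.
    exact: compact_unif_continuous (@cube_compact R n r) (@H_cont i) e'0.
  move=> /filter_ex[d [d0 Hd]].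
  have [x xK Hx] := poincare_miranda_approx d0 Hd.
  apply: le_trans (F_min x (mem_set xK)) _.
  apply: (@le_trans _ _ (\sum_(i < n) e')); first exact: ler_sum.
  rewrite sumr_const card_ord -mulr_natr /e' mulrAC ler_pdivrMr ?ltr0n //.
  by rewrite ler_pM2l // ler_nat.
exists x0; first exact: set_mem x0K.
move=> i; apply/eqP; rewrite -normr_le0.
apply: le_trans F0; rewrite /F (bigD1 i) //= lerDl.
by apply: sumr_ge0.
Unshelve. all: by end_near.
Qed.

End PoincareMiranda.

Local Close Scope classical_set_scope.

(** * Tensor equations *)

Section Tensor.
Variables (R : realType) (m n : nat).
Implicit Types (A G : tensor R m.+1 n) (Q : 'M[R]_n) (x : 'cV[R]_n).

Lemma tensor_apply_mul Q A x :
  tensor_apply (mx_tensor_mul Q A) x = Q *m tensor_apply A x.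
Proof.
apply/colP => i; rewrite !mxE.
under eq_bigr do rewrite ffunE mulr_suml.
rewrite exchange_big /=; apply: eq_bigr => k _.
rewrite mxE mulr_sumr; apply: eq_bigr => J _.
rewrite mulrA theadE; congr (_ * A _ * _); congr cons_tuple.
exact: val_inj.
Qed.

Lemma tensor_apply_unit x i :
  tensor_apply (tensor_unit R m.+1 n) x i 0 = x i 0 ^+ m.
Proof.
rewrite mxE (bigD1 (nseq_tuple m i)) //= [X in _ + X]big1 ?addr0.
  rewrite ffunE /= all_pred1_nseq mul1r.
  under eq_bigr do rewrite (tnth_nth i) nth_nseq ltn_ord.
  by rewrite prodr_const card_ord.
move=> J Ji; rewrite ffunE /= (_ : all _ _ = false) ?mul0r //.
apply: contraNF Ji => /all_pred1P JE; apply/eqP/val_inj => /=.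
by rewrite JE size_tuple.
Qed.

Lemma tensor_norm_inf_row G i :
  \sum_(J : m.-tuple 'I_n) `|G (cons_tuple i J)| <= tensor_norm_inf G.
Proof. exact: (le_bigmax_cond _ (fun i => \sum_J `|G (cons_tuple i J)|)). Qed.

Lemma tensor_apply_le G x r i : (forall j, `|x j 0| <= r) ->
  `|tensor_apply G x i 0| <= tensor_norm_inf G * r ^+ m.
Proof.
move=> xr; rewrite mxE; apply: le_trans (ler_norm_sum _ _ _) _.
have r0 := le_trans (normr_ge0 _) (xr i).
apply: le_trans (ler_wpM2r (exprn_ge0 _ r0) (tensor_norm_inf_row G i)).
rewrite mulr_suml; apply: ler_sum => J _; rewrite normrM ler_wpM2l //.
rewrite normr_prod -[X in _ ^+ X](card_ord m) -prodr_const.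
by apply: ler_prod => k _; rewrite normr_ge0 xr.
Qed.

End Tensor.

Lemma tensor_apply_abs_continuous (R : realType) m n (G : tensor R m.+1 n)
    (i : 'I_n) :
  continuous (fun z : 'rV[R]_n => tensor_apply G (vec_abs z^T) i 0).
Proof.
under eq_fun do rewrite mxE.
apply: continuous_sum => J z; apply: continuousM; first exact: cst_continuous.
apply: continuous_prod => k {}z.
under eq_fun do rewrite !mxE.
by apply: continuous_comp; [exact: coord_continuous|exact: norm_continuous].
Qed.

(** For odd [m] the power [t ^+ m] has the sign of [t], and on the cube of
    half-side [r] the tensor term is at most [tensor_norm_inf G * r ^+ m] in
    absolute value.  Since the norm is less than 1, the power dominates both
    this term and [c] on the faces of a large cube, which are the hypotheses of
    the Poincare-Miranda theorem. *)
Lemma power_add_abs_tensor_solvable (R : realType) m n (G : tensor R m.+1 n)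
    (c : 'cV[R]_n) : odd m -> tensor_norm_inf G < 1 ->
  exists x : 'cV[R]_n,
    forall i, x i 0 ^+ m + tensor_apply G (vec_abs x) i 0 = c i 0.
Proof.
move=> m_odd; set rho := tensor_norm_inf G => rho1.
have rho1' : 0 < 1 - rho by rewrite subr_gt0.
(* [1 <= r] gives [r <= r ^+ m], and the second summand makes
   [(1 - rho) * r] exceed every [`|c i 0|]. *)
pose r := 1 + (\sum_(i < n) `|c i 0|) / (1 - rho).
have r1 : 1 <= r by rewrite lerDl divr_ge0 ?sumr_ge0 // ltW.
have c_le i : `|c i 0| <= (1 - rho) * r ^+ m.
  apply: (@le_trans _ _ ((1 - rho) * r)); last first.
    by rewrite ler_pM2l // -{1}(expr1 r) ler_weXn2l // odd_gt0.
  rewrite /r mulrDr mulr1 mulrCA mulfV ?mulr1 ?gt_eqF //.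
  by rewrite (bigD1 i) //= addrCA lerDl addr_ge0 ?sumr_ge0 // ltW.
pose H i (z : 'rV[R]_n) :=
  z 0 i ^+ m + tensor_apply G (vec_abs z^T) i 0 - c i 0.
have G_le (i : 'I_n) (z : 'rV[R]_n) : cube r z ->
    `|tensor_apply G (vec_abs z^T) i 0| <= rho * r ^+ m.
  move=> zr; apply: tensor_apply_le => j; rewrite !mxE normr_id ler_norml.
  by have := zr j; rewrite in_itv.
have H_cont i : continuous (H i).
  have shift (V : topologicalType) (f g : V -> R) (a : R) :
      continuous f -> continuous g -> continuous (fun x => f x + g x - a).
    move=> cf cg x; apply: (@continuousB _ _ _ (fun x => f x + g x) (fun=> a)).
      by apply: continuousD; [exact: cf|exact: cg].
    exact: cst_continuous.
  apply: shift; last exact: tensor_apply_abs_continuous.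
  move=> z.
  apply: (@continuous_comp _ _ _ (fun z : 'rV[R]_n => z 0 i) (fun t => t ^+ m)).
    exact: coord_continuous.
  exact: exprn_continuous.
have r_gt0 : 0 < r by lra.
have H_low (i : 'I_n) (z : 'rV[R]_n) : cube r z -> z 0 i = - r -> H i z <= 0.
  move=> zr zi; have := G_le i z zr; have := c_le i; rewrite !ler_norml /H zi.
  by rewrite exprNn -signr_odd m_odd expr1; lra.
have H_high (i : 'I_n) (z : 'rV[R]_n) : cube r z -> z 0 i = r -> 0 <= H i z.
  move=> zr zi; have := G_le i z zr; have := c_le i; rewrite !ler_norml /H zi.
  by lra.
have [z _ Hz] := poincare_miranda r_gt0 H_low H_high H_cont.
exists z^T => i; have := Hz i; rewrite /H [z^T i 0]mxE.
by move/eqP; rewrite subr_eq0 => /eqP.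
Qed.

Theorem theorem3p6 (R : realType) (m n : nat) (A B : tensor R m.+1 n)
    (n_gt0 : (0 < n)%N)
    (p_even : ~~ odd m.+1)
    (MA_unit : majorization_mx A \in unitmx)
    (MA_left_inverse :
      unique (order2_left_inverse A) (invmx (majorization_mx A)))
    (norm_lt1 :
      tensor_norm_inf (mx_tensor_mul (invmx (majorization_mx A)) B) < 1)
    (b : 'cV[R]_n) :
  exists x : 'cV[R]_n, tensor_apply A x + tensor_apply B (vec_abs x) = b.
Proof.
set Q := invmx (majorization_mx A) in MA_left_inverse norm_lt1.
have Q_unit : Q \in unitmx by rewrite unitmx_inv.
have m_odd : odd m by rewrite /= negbK in p_even.
have [x Hx] := power_add_abs_tensor_solvable (Q *m b) m_odd norm_lt1.
exists x; apply: (can_inj (mulKmx Q_unit)).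
rewrite mulmxDr -!tensor_apply_mul.
have [QA _] := MA_left_inverse; rewrite QA.
by apply/colP => i; rewrite mxE tensor_apply_unit Hx.
Qed.
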